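(* Let $\xi\colon\mathcal{E}\to M$ be a formally integrable infinitely prolonged differential equation with a flat representation $\mathcal{F}$ in a fiber bundle $\pi\colon M\to N$, and let $U=\bar U_{\mathcal{F}}$. The symmetries $S\in\mathrm{sym}\,\mathcal{E}$ whose cocycles $c_S=[\![U,S]\!]\in\mathcal{V}_{\mathcal{E}}^1$ are exact, i.e. such that $c_S=[\![U,V]\!]$ for some $V\in\mathcal{V}_{\mathcal{E}}$, form a Lie subalgebra in $\mathrm{sym}\,\mathcal{E}$.
   Context: Equations and symmetries. $\xi\colon\mathcal{E}\to M$ is the infinite prolongation of a formally integrable PDE with space of independent variables $M$. It carries the flat Cartan connection $\mathcal{C}$ lifting vector fields on $M$ to vector fields on $\mathcal{E}$; $\mathcal{C}\mathrm{D}$ is the $C^\infty(\mathcal{E})$-module generated by all $\mathcal{C}X$ (the Cartan distribution). $\mathrm{sym}\,\mathcal{E}$ is the real Lie algebra (under commutator) of symmetries, i.e. $\xi$-vertical vector fields $S$ on $\mathcal{E}$ with $[S,\mathcal{C}\mathrm{D}]\subset\mathcal{C}\mathrm{D}$ (equivalently, $[S,\mathcal{C}X]=0$ for all vector fields $X$ on $M$). Flat representation. Let $\eta=\pi\circ\xi\colon\mathcal{E}\to N$. A flat representation is a flat connection $\mathcal{F}$ in $\eta$ (a $C^\infty(N)$-linear lift of vector fields, $\eta_*\mathcal{F}(X)=X$, $\mathcal{F}[X,Y]=[\mathcal{F}X,\mathcal{F}Y]$) such that $\mathcal{F}(X)\in\mathcal{C}\mathrm{D}$ for every vector field $X$ on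 $N$. In local coordinates $x_i$ on $N$, $\bar U_{\mathcal{F}}=\sum_i dx_i\otimes\mathcal{F}(\partial_{x_i})$, a vector-field-valued $1$-form on $\mathcal{E}$. Complex. $\mathcal{V}_{\mathcal{E}}\subset\mathcal{C}\mathrm{D}$ is the submodule of $\eta$-vertical fields in the Cartan distribution, and $\mathcal{V}_{\mathcal{E}}^q=\eta^*(\Lambda^q(N))\otimes\mathcal{V}_{\mathcal{E}}$. With $[\![\cdot,\cdot]\!]$ the Frölicher–Nijenhuis bracket and $\partial_U=[\![U,\cdot\,]\!]$, one has $\partial_U(\mathcal{V}_{\mathcal{E}}^q)\subset\mathcal{V}_{\mathcal{E}}^{q+1}$ and $\partial_U^2=0$, so that $(\mathcal{V}_{\mathcal{E}}^\bullet,\partial_U)$ is a complex. For any symmetry $S$, $c_S=[\![U,S]\!]=\sum_i dx_i\otimes[\mathcal{F}(\partial_{x_i}),S]$ is a $1$-cocycle of this complex (in general not exact, since $S\notin\mathcal{V}_{\mathcal{E}}$). *)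

(* Defs.v *)
From HB Require Import structures.
From mathcomp Require Import all_boot all_order all_algebra.
From mathcomp Require Import ring.
From mathcomp Require Import all_classical all_reals all_analysis.
Import Order.TTheory GRing.Theory Num.Theory.
Import numFieldNormedType.Exports.

Set Implicit Arguments.
Unset Strict Implicit.
Unset Printing Implicit Defensive.

Local Open Scope classical_set_scope.
Local Open Scope ring_scope.

Definition iter_partial (R : realType) n (s : seq 'I_n) (f : 'rV[R]_n -> R)
    : 'rV[R]_n -> R :=
  foldr (fun i h x => 'D_(delta_mx 0 i) h x) f s.

(* for V open this is the class C^oo(V); values outside V are irrelevant *)
Definition smooth_on (R : realType) n (V : set 'rV[R]_n) (f : 'rV[R]_n -> R) :=
  forall s x, V x -> differentiable (iter_partial s f) x.

Lemma smooth_on_closed (R : realType) n (Q : set ('rV[R]_n -> R)) :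
    (forall f x, Q f -> differentiable f x) ->
    (forall f i, Q f -> Q (fun x => 'D_(delta_mx 0 i) f x)) ->
  forall f, Q f -> smooth_on setT f.
Proof.
move=> Qd QD f Qf s x _; apply: Qd.
by elim: s => //= i s IH; exact: QD.
Qed.

Lemma smooth_cst (R : realType) n (c : R) : smooth_on setT (fun _ : 'rV[R]_n => c).
Proof.
apply: (@smooth_on_closed _ _ [set f | exists c, f = fun=> c]); last by exists c.
  by move=> _ x [d ->].
by move=> _ i [d ->]; exists 0; apply/funext => x; rewrite derive_cst.
Qed.

Lemma is_derive_coord (R : realType) n (i : 'I_n) (x v : 'rV[R]_n) :
  is_derive x v (fun y : 'rV[R]_n => y 0 i) (v 0 i).
Proof.
have dx := differentiable_coord x 0 i.
apply: DeriveDef; first exact: diff_derivable.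
rewrite deriveE //.
have @f : {linear 'rV[R]_n -> R}.
  by exists (fun y : 'rV[R]_n => y 0 i); do 2![eexists]; do ?[constructor];
     rewrite ?mxE// => ? *; rewrite ?mxE//; move=> ?; rewrite !mxE.
rewrite (_ : (fun _ => _) = f :> (_ -> _)) // diff_lin //; exact: coord_continuous.
Qed.

Lemma smooth_bilinear (R : realType) (b c d : R) :
  smooth_on setT (fun x : 'rV[R]_2 => b * x 0 0 + c * x 0 1 + d * (x 0 0 * x 0 1)).
Proof.
pose p (i : 'I_2) : 'rV[R]_2 -> R := fun x => x 0 i.
pose q (a b c d : R) : 'rV[R]_2 -> R :=
  cst a + cst b * p 0 + cst c * p 1 + cst d * (p 0 * p 1).
rewrite (_ : (fun _ => _) = q 0 b c d); last first.
  by apply/funext => x; rewrite /q !fctE add0r.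
apply: (@smooth_on_closed _ _ [set f | exists a b c d, f = q a b c d]);
  last by exists 0, b, c, d.
  have dp i x : differentiable (p i) x by exact: differentiable_coord.
  move=> _ x [a1 [b1 [c1 [d1 ->]]]]; rewrite /q.
  by repeat (first [apply: dp | apply: differentiable_cst |
    apply: differentiableD | apply: differentiableM]).
move=> _ i [a1 [b1 [c1 [d1 ->]]]]; pose v : 'rV[R]_2 := delta_mx 0 i.
exists (b1 * v 0 0 + c1 * v 0 1), (d1 * v 0 1), (d1 * v 0 0), 0.
apply/funext => x; rewrite -/v.
have Dp j : is_derive x v (p j) (v 0 j) by exact: is_derive_coord.
have H (e : R) f df : is_derive x v f df -> is_derive x v (cst e * f) (e * df).
  move=> Hf; have := is_deriveM (is_derive_cst e x v) Hf.
  by rewrite scaler0 addr0.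
have := is_deriveD (is_deriveD (is_deriveD (is_derive_cst a1 x v)
  (H b1 _ _ (Dp 0))) (H c1 _ _ (Dp 1))) (H d1 _ _ (is_deriveM (Dp 0) (Dp 1))).
move=> D; rewrite [LHS](@derive_val _ _ _ _ _ _ _ D) /q !fctE /p.
rewrite /GRing.scale /=; ring.
Qed.

(* Superposition with smooth functions of finitely many real variables, and     *)
(* localisation in the initial topology: the two axioms of a (Sikorski)         *)
(* differential structure. A smooth manifold is treated through its algebra of  *)
(* smooth functions, and the same objects serve for spaces of jets and for the  *)
(* infinite-dimensional space of an infinitely prolonged equation. Localisation *)
(* is not part of the record because it fails for functions on infinite jets    *)
(* that are required to be globally of finite order.                            *)
Definition superposition_closed (R : realType) (T : Type) (C : set (T -> R)) :=
  forall n (g : 'I_n -> T -> R) (G : 'rV[R]_n -> R), (forall i, C (g i)) ->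
  smooth_on setT G -> C (fun p => G (\row_i g i p)).

Record fspace (R : realType) := FSpace {
  fpt :> Type ;
  fsmooth : set (fpt -> R) ;
  fspaceP : superposition_closed fsmooth }.

HB.instance Definition _ R (X : fspace R) := gen_eqMixin (fpt X).
HB.instance Definition _ R (X : fspace R) := gen_choiceMixin (fpt X).

(* the initial topology for the smooth functions *)
Definition fspace_topology (R : realType) (X : fspace R) : Type :=
  sup_topology (fun f : {f : fpt X -> R | fsmooth f} =>
    Topological.class (initial_topology (sval f))).
HB.instance Definition _ R (X : fspace R) := Topological.on (fspace_topology X).
HB.instance Definition _ R (X : fspace R) :=
  Topological.copy (fpt X) (fspace_topology X).

Section SmoothFunctions.
Context {R : realType}.
Implicit Types X Y : fspace R.

Definition localization_closed X := forall f : X -> R,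
  (forall p : X, exists2 g : X -> R, fsmooth g & \forall q \near p, f q = g q) ->
  fsmooth f.

Definition smooth_pred X : {pred (X -> R^o)} := mem (@fsmooth R X).
Arguments smooth_pred X : clear implicits.

Record Cinf X := MkCinf {
  cfun :> X -> R^o ;
  cfunP : cfun \in smooth_pred X }.

Lemma smooth_pred_bilinear X (f g : X -> R^o) :
  f \in smooth_pred X -> g \in smooth_pred X -> forall b c d : R,
  (fun p => b * f p + c * g p + d * (f p * g p) : R^o) \in smooth_pred X.
Proof.
move=> /set_mem sf /set_mem sg b c d; apply/mem_set.
pose h (i : 'I_2) : X -> R := if i == 0 then f else g.
have sh i : fsmooth (h i) by rewrite /h; case: ifP.
have := fspaceP sh (smooth_bilinear b c d).
by congr fsmooth; apply/funext => p; rewrite !mxE.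
Qed.

Lemma smooth_pred_subring X : subring_closed (smooth_pred X).
Proof.
split.
- have no0 (i : 'I_0) : fsmooth (fun _ : X => 0 : R) by case: i.
  exact/mem_set/(fspaceP no0 (smooth_cst 1)).
- move=> f g /smooth_pred_bilinear /[apply] /(_ 1 (-1) 0).
  rewrite (_ : (fun p => _) = f - g) //.
  by apply/funext => p; rewrite !fctE mul1r mulN1r mul0r addr0.
- move=> f g /smooth_pred_bilinear /[apply] /(_ 0 0 1).
  rewrite (_ : (fun p => _) = f * g) //.
  by apply/funext => p; rewrite !fctE !mul0r mul1r !add0r.
Qed.

Lemma smooth_pred_scale X : scaler_closed (smooth_pred X).
Proof.
move=> a f sf; have := smooth_pred_bilinear sf sf a 0 0.
rewrite (_ : (fun p => _) = a *: f) //.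
by apply/funext => p; rewrite !mul0r !addr0.
Qed.

HB.instance Definition _ X :=
  GRing.isSubringClosed.Build (X -> R^o) (smooth_pred X) (@smooth_pred_subring X).
HB.instance Definition _ X :=
  GRing.isScaleClosed.Build R (X -> R^o) (smooth_pred X) (@smooth_pred_scale X).

HB.instance Definition _ X := [isSub for @cfun X].
HB.instance Definition _ X := [Choice of Cinf X by <:].
HB.instance Definition _ X := 
  GRing.SubChoice_isSubComPzRing.Build _ _ (Cinf X) (subringClosedP _).
HB.instance Definition _ X := [SubZmodule_isSubLmodule of Cinf X by <:].

Record smap X Y := SMap {
  sfun :> X -> Y ;
  sfunP : forall g : Y -> R, fsmooth g -> fsmooth (g \o sfun) }.

Definition smap_comp X Y Z (g : smap Y Z) (f : smap X Y) : smap X Z :=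
  @SMap X Z (g \o f) (fun h sh => sfunP f (sfunP g sh)).

Definition pull X Y (h : smap X Y) (f : Cinf Y) : Cinf X :=
  @MkCinf X (f \o h) (mem_set (sfunP h (set_mem (cfunP f)))).

Definition derivation X : set (Cinf X -> Cinf X) :=
  [set D : Cinf X -> Cinf X |
    linear D /\ forall f g : Cinf X, D (f * g) = D f * g + f * D g].

Definition derivation_pred X : {pred (Cinf X -> Cinf X)} := mem (@derivation X).
Arguments derivation_pred X : clear implicits.

Record vfield X := MkVfield {
  vfun :> Cinf X -> Cinf X ;
  vfunP : vfun \in derivation_pred X }.

Lemma vfield_derivation X (A : vfield X) : derivation A.
Proof. exact/set_mem/vfunP. Qed.

Lemma Cinf_scalerAl X (a : R) (f g : Cinf X) : a *: (f * g) = (a *: f) * g.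
Proof.
apply: val_inj; rewrite [LHS]GRing.valZ !GRing.valM GRing.valZ.
by apply/funext => p; rewrite !fctE; exact: mulrA.
Qed.

Lemma derivation_pred_submod X : submod_closed (derivation_pred X).
Proof.
split.
- apply/mem_set; have E (h : Cinf X) : (0 : Cinf X -> Cinf X) h = 0 by [].
  split=> [a f g|f g]; first by rewrite !E scaler0 addr0.
  by rewrite !E mul0r mulr0 addr0.
- move=> a D1 D2 /set_mem[l1 p1] /set_mem[l2 p2]; apply/mem_set.
  have E (h : Cinf X) : (a *: D1 + D2) h = a *: D1 h + D2 h by [].
  split=> [c f g|f g]; rewrite !E.
    by rewrite l1 l2 !scalerDr !scalerA [a * c]mulrC addrACA.
  rewrite p1 p2 [(_ + _) * g]mulrDl [f * (_ + _)]mulrDr scalerDr addrACA.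
  by rewrite Cinf_scalerAl [f * (_ *: _)]mulrC [f * D1 g]mulrC Cinf_scalerAl.
Qed.

HB.instance Definition _ X := GRing.isSubmodClosed.Build R (Cinf X -> Cinf X)
  (derivation_pred X) (derivation_pred_submod X).

HB.instance Definition _ X := [isSub for @vfun X].
HB.instance Definition _ X := [Choice of vfield X by <:].
HB.instance Definition _ X := [SubChoice_isSubLmodule of vfield X by <:].

Lemma fscale_subproof X (f : Cinf X) (A : vfield X) :
  (fun g => f * A g) \in derivation_pred X.
Proof.
have [lA pA] := vfield_derivation A; apply/mem_set; split=> [a g h|g h].
  by rewrite lA mulrDr mulrC -Cinf_scalerAl [A g * f]mulrC.
by rewrite pA mulrDr !mulrA [f * g]mulrC.
Qed.

Definition fscale X (f : Cinf X) (A : vfield X) := MkVfield (fscale_subproof f A).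

Lemma lie_subproof X (A B : vfield X) :
  (fun g => A (B g) - B (A g)) \in derivation_pred X.
Proof.
have [lA pA] := vfield_derivation A; have [lB pB] := vfield_derivation B.
have aA g h : A (g + h) = A g + A h by rewrite -[g]scale1r lA !scale1r.
have aB g h : B (g + h) = B g + B h by rewrite -[g]scale1r lB !scale1r.
apply/mem_set; split=> [a g h|g h].
  rewrite lB lA lA lB scalerBr opprD addrACA //.
rewrite pB pA aA aB !pA !pB; ring.
Qed.

Definition lie X (A B : vfield X) := MkVfield (lie_subproof A B).

(* the smallest differential structure containing G *)
Definition generated (T : Type) (G : set (T -> R)) : set (T -> R) :=
  [set f | forall (H : set (T -> R)) (HP : superposition_closed H),
    localization_closed (FSpace HP) -> G `<=` H -> H f].

Lemma generated_superposition (T : Type) (G : set (T -> R)) :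
  superposition_closed (generated G).
Proof.
move=> n g F gG sF H HP HL GH; apply: (HP) => // i.
exact: gG HL GH.
Qed.

Definition gen_fspace (T : Type) (G : set (T -> R)) : fspace R :=
  FSpace (@generated_superposition T G).

Lemma generatedS (T : Type) (G1 G2 : set (T -> R)) :
  G1 `<=` G2 -> generated G1 `<=` generated G2.
Proof. by move=> G12 f fG H HP HL GH; exact: fG HL (subset_trans G12 GH). Qed.

Lemma sub_generated (T : Type) (G : set (T -> R)) : G `<=` generated G.
Proof. by move=> f Gf H HP HL; apply. Qed.

Definition sub_fspace X (A : set X) : fspace R :=
  @gen_fspace {p : X | A p} [set f | exists2 g : Cinf X, True & f = g \o sval].

Definition prod_fspace X Y : fspace R :=
  @gen_fspace (X * Y)%type
    ([set f | exists g : Cinf X, f = g \o fst] `|`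
     [set f | exists g : Cinf Y, f = g \o snd]).

Definition diffeo X Y (h : X -> Y) :=
  [/\ bijective h,
      forall g : Y -> R, fsmooth g -> fsmooth (g \o h) &
      forall f : X -> R, fsmooth f -> exists2 g : Y -> R, fsmooth g & f = g \o h].

(* The functions x_0, .., x_(n-1), smooth on the whole of X, restrict to a chart *)
(* on the open set U.                                                            *)
Definition local_coords n X (U : set X) (x : 'I_n -> Cinf X) :=
  let phi (p : X) : 'rV[R]_n := \row_i x i p in
  [/\ open U, set_inj U phi, open (phi @` U) &
    forall f : Cinf X, exists2 G : 'rV[R]_n -> R,
      smooth_on (phi @` U) G & forall p, U p -> f p = G (phi p)].

Definition manifold n X :=
  [/\ localization_closed X, hausdorff_space X, @second_countable X &
    forall p : X, exists (U : set X) (x : 'I_n -> Cinf X),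
      U p /\ local_coords U x].

Definition fiber_bundle X Y (h : smap X Y) :=
  (forall y, exists x, h x = y) /\
  forall y : Y, exists W : set Y, open_nbhs y W /\
    exists m (F : fspace R), manifold m F /\
    exists t : sub_fspace (h @^-1` W) -> prod_fspace (sub_fspace W) F,
      diffeo t /\ forall p, sval (t p).1 = h (sval p).

Definition flat_connection X Y (h : smap X Y) (nabla : vfield Y -> vfield X) :=
  [/\ forall (f : Cinf Y) A B,
        nabla (fscale f A + B) = fscale (pull h f) (nabla A) + nabla B,
      forall A (f : Cinf Y), nabla A (pull h f) = pull h (A f) &
      forall A B, nabla (lie A B) = lie (nabla A) (nabla B)].

Definition vertical X Y (h : smap X Y) : set (vfield X) :=
  [set A | forall f : Cinf Y, A (pull h f) = 0].

Definition lie_subalgebra X (L K : set (vfield X)) :=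
  [/\ K `<=` L, K 0, forall (a : R) A B, K A -> K B -> K (a *: A + B) &
      forall A B, K A -> K B -> K (lie A B)].

(* D(X)-valued 1-forms on X *)
Definition vvform1 X (U : vfield X -> vfield X) :=
  forall (f : Cinf X) A B, U (fscale f A + B) = fscale f (U A) + U B.

(* the Froelicher-Nijenhuis bracket [[U, S]] of a vector-valued 1-form with a    *)
(* vector field, i.e. with a vector-valued 0-form                                *)
Definition FN_bracket X (U : vfield X -> vfield X) (S : vfield X)
    : vfield X -> vfield X :=
  fun A => lie (U A) S - U (lie A S).

End SmoothFunctions.

(* Jets of local sections of rho : P -> M. A germ at x of a local section is     *)
(* represented by a map M -> P that is a smooth section near x. The order of a   *)
(* jet is either Some k or None, the latter standing for infinity. A word w of   *)
(* vector fields on M acts as a differential operator of order at most size w,   *)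
(* and two germs s, s' have the same k-jet at x if w(f o s)(x) = w(f o s')(x)    *)
(* for all f in C^oo(P) and all w of length at most k.                           *)
Section Jets.
Context {R : realType} {P M : fspace R} (rho : smap P M).

Definition order_le (k : option nat) (r : nat) : bool :=
  if k is Some n then (r <= n)%N else true.

Definition iter_vfield (w : seq (vfield M)) (g : Cinf M) : Cinf M :=
  foldr (fun (A : vfield M) h => A h) g w.

Definition section_at (x : M) (s : M -> P) :=
  exists W : set M, [/\ open_nbhs x W, forall q, W q -> rho (s q) = q &
    forall f : Cinf P, exists g : Cinf M, forall q, W q -> f (s q) = g q].

Definition same_jet (k : option nat) (x : M) (s s' : M -> P) :=
  forall (f : Cinf P) (g g' : Cinf M) w, order_le k (size w) ->
    (\forall q \near x, f (s q) = g q) -> (\forall q \near x, f (s' q) = g' q) ->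
    iter_vfield w g x = iter_vfield w g' x.

Record jet (k : option nat) := Jet {
  jbase : M ;
  jclass : set (M -> P) ;
  jetP : exists2 s, section_at jbase s &
    jclass = [set s' | section_at jbase s' /\ same_jet k jbase s s'] }.

Definition jet_of k x s (h : section_at x s) : jet k :=
  @Jet k x [set s' | section_at x s' /\ same_jet k x s s'] (ex_intro2 _ _ s h erefl).

(* meant for l <= k *)
Definition truncate k l (t : jet k) : jet l :=
  jet_of l (svalP (cid (let: ex_intro2 s h _ := jetP t in ex_intro _ s h))).

(* the functions w(f o s)(x) on jets, of order at most n *)
Definition jet_coord k n : set (jet k -> R) :=
  [set phi | exists (f : Cinf P) (w : seq (vfield M)), (size w <= n)%N /\
    forall t s (g : Cinf M), jclass t s -> (\forall q \near jbase t, f (s q) = g q) ->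
      phi t = iter_vfield w g (jbase t)].

Definition jetspace (k : nat) : fspace R := gen_fspace (@jet_coord (Some k) k).

(* g represents Phi o j^k(s) near x *)
Definition along_jet k (Phi : Cinf (jetspace k)) (s : M -> P) (x : M) (g : Cinf M) :=
  \forall q \near x, forall h : section_at q s, Phi (jet_of (Some k) h) = g q.

(* A differential equation of order k is a set E0 of k-jets. Its l-th            *)
(* prolongation consists of the (k+l)-jets at x of the sections s such that the  *)
(* graph of j^k(s) is tangent to E0 at j^k_x(s) with order at least l.           *)
Definition prolongation k (E0 : set (jetspace k)) (l : option nat)
    : set (jet (omap (addn k) l)) :=
  [set t | E0 (truncate (Some k) t) /\
    forall Phi : Cinf (jetspace k), (forall t0, E0 t0 -> Phi t0 = 0) ->
    forall s (g : Cinf M) w, jclass t s -> along_jet Phi s (jbase t) g ->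
      order_le l (size w) -> iter_vfield w g (jbase t) = 0].

Arguments prolongation {k} E0 l _.

Definition prolonged k (E0 : set (jetspace k)) (l : nat) : fspace R :=
  sub_fspace (prolongation E0 (Some l) : set (jetspace (k + l))).

Definition formally_integrable k (E0 : set (jetspace k)) := forall l,
  (exists d, manifold d (prolonged E0 l)) /\
  exists p : smap (prolonged E0 l.+1) (prolonged E0 l),
    (forall t, sval (p t) = truncate (Some (k + l)%N) (sval t)) /\ fiber_bundle p.

Definition inf_points k (E0 : set (jetspace k)) := {t : jet None | prolongation E0 None t}.

(* functions of finite order on the infinite prolongation *)
Definition inf_smooth k (E0 : set (jetspace k)) : set (inf_points E0 -> R) :=
  [set f | exists n,
    generated [set phi | exists2 psi, jet_coord n psi & phi = psi \o sval] f].

Lemma inf_superposition k (E0 : set (jetspace k)) :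
  superposition_closed (@inf_smooth k E0).
Proof.
move=> n g G /choice[r rP] sG; exists (\max_i r i)%N.
apply: generated_superposition sG => i.
apply: generatedS (rP i) => _ [psi [f [w [wr psiE]]] ->]; exists psi => //.
by exists f, w; split => //; apply: leq_trans wr _; exact: leq_bigmax.
Qed.

Definition inf_prolongation k (E0 : set (jetspace k)) : fspace R :=
  FSpace (@inf_superposition k E0).

Lemma inf_base_subproof k (E0 : set (jetspace k)) (g : M -> R) : fsmooth g ->
  fsmooth (g \o (fun t : inf_prolongation E0 => jbase (sval t))).
Proof.
move=> sg; exists 0%N; apply: sub_generated.
exists (g \o @jbase None) => //; pose g' := MkCinf (mem_set sg).
exists (pull rho g'), [::]; split=> // t s h ts.
have {ts} [W [[oW Wt] sW _]] : section_at (jbase t) s.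
  by move: ts; case: t => x c [s0 _ /= ->] [].
by move=> /nbhs_singleton /= <-; rewrite sW.
Qed.

(* xi : E -> M *)
Definition inf_base k (E0 : set (jetspace k)) : smap (inf_prolongation E0) M :=
  SMap (@inf_base_subproof k E0).

(* The Cartan connection lifts X to the total derivative along X, determined by  *)
(* (C X f) o j^oo(s) = X (f o j^oo(s)). As j^oo(s) need not take values in E,    *)
(* f is replaced by a function Phi of jets of finite order that extends it       *)
(* locally. This determines C; that C is a flat connection is a consequence,     *)
(* included here because it is part of the structure carried by E.               *)
Definition cartan_connection k (E0 : set (jetspace k))
    (C : vfield M -> vfield (inf_prolongation E0)) :=
  flat_connection (inf_base E0) C /\
  forall (X : vfield M) (f : Cinf (inf_prolongation E0)) (t : inf_prolongation E0)
      n (Phi : Cinf (jetspace n)),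
    (\forall u \near (truncate (Some n) (sval t) : jetspace n),
      forall t' : inf_prolongation E0, truncate (Some n) (sval t') = u -> f t' = Phi u) ->
    forall s (g : Cinf M), jclass (sval t) s -> along_jet Phi s (jbase (sval t)) g ->
      C X f t = X g (jbase (sval t)).

End Jets.

Section Symmetries.
Context {R : realType} {E M N : fspace R} (xi : smap E M) (pi : smap M N).
Variable C : vfield M -> vfield E.

Definition cartan_distribution : set (vfield E) :=
  [set A | exists n (a : 'I_n -> Cinf E) (X : 'I_n -> vfield M),
    A = \sum_i fscale (a i) (C (X i))].

Definition symmetry : set (vfield E) :=
  [set S | vertical xi S /\
    forall A, cartan_distribution A -> cartan_distribution (lie S A)].

Definition eta : smap E N := smap_comp pi xi.

Definition flat_representation (F : vfield N -> vfield E) :=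
  flat_connection eta F /\ forall X, cartan_distribution (F X).

(* U = sum_i dx_i (x) F(d/dx_i) in local coordinates x_i on N; the vector fields  *)
(* D i coincide with d/dx_i on O.                                                *)
Definition connection_form (F : vfield N -> vfield E) (U : vfield E -> vfield E) :=
  vvform1 U /\
  forall n (O : set N) (x : 'I_n -> Cinf N) (D : 'I_n -> vfield N),
    local_coords O x ->
    (forall i j q, O q -> D i (x j) q = (i == j)%:R) ->
    forall (A : vfield E) (f : Cinf E) (t : E), O (eta t) ->
      U A f t = \sum_i A (pull eta (x i)) t * F (D i) f t.

(* the module V_E = V_E^0 of the complex *)
Definition vertical_cartan : set (vfield E) :=
  [set V | cartan_distribution V /\ vertical eta V].

Definition exact_symmetry (U : vfield E -> vfield E) : set (vfield E) :=
  [set S | symmetry S /\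
    exists2 V, vertical_cartan V & FN_bracket U S = FN_bracket U V].

End Symmetries.

(* Main.v *)
Require Import Defs.
From mathcomp Require Import all_boot all_order all_algebra.
From mathcomp Require Import ring.
From mathcomp Require Import all_classical all_reals all_analysis.
Import Order.TTheory GRing.Theory Num.Theory.

(* For fixed U the map S |-> [[U, S]] is, up to sign, S |-> L_S U, so its kernel *)
(* is closed under commutators. If S and T have exact cocycles with potentials V *)
(* and W, then S - V and T - W lie in that kernel, hence so does                 *)
(* [S - V, T - W], and [S, T] has the potential [S, W] + [V, T] - [V, W]. This   *)
(* is an eta-vertical Cartan field, because symmetries preserve the Cartan       *)
(* distribution, which is involutive by flatness.                                *)

(** Vanishing of $[\![U,S]\!]$ means that $U$, as an operator on vector fields, commutes with $A
    \mapsto [A,S]$; by the Jacobi identity the commutator of two such operators comes from the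
    commutator of the fields, which gives [FN_bracket_lie]. Exactness of $c_S$ says that $S$ lies in
    this kernel modulo $\mathcal{V}_{\mathcal{E}}$ ([FN_bracket_eq]). What remains is that
    $\mathcal{V}_{\mathcal{E}}$ is a Lie algebra ([vertical_cartan_lie]) on which symmetries act
    ([symmetry_lie_vertical_cartan]); [exact_symmetry_subalgebra] assembles these facts. *)

Local Open Scope classical_set_scope.
Local Open Scope ring_scope.

(** * Lie algebra of vector fields and the bracket with a vector-valued 1-form *)

Section VectorFields.
Context {R : realType} {X : fspace R}.
Implicit Types (A B S T V W : vfield X) (f g : Cinf X).

Lemma vfield_ext A B : (forall g, A g = B g) -> A = B.
Proof. by move=> AB; apply/val_inj/funext. Qed.

Lemma vfield0E g : (0 : vfield X) g = 0.
Proof. by []. Qed.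

Lemma vfieldDE A B g : (A + B) g = A g + B g.
Proof. by []. Qed.

Lemma vfieldNE A g : (- A) g = - A g.
Proof. by []. Qed.

Lemma vfieldZE (a : R) A g : (a *: A) g = a *: A g.
Proof. by []. Qed.

Lemma fscaleE f A g : fscale f A g = f * A g.
Proof. by []. Qed.

Lemma lieE A B g : lie A B g = A (B g) - B (A g).
Proof. by []. Qed.

Lemma vfieldZr A (a : R) g : A (a *: g) = a *: A g.
Proof.
have [lA _] := vfield_derivation A.
(* Linearity is the single identity $D(af+g) = a\,Df + Dg$; at $a=-1$, $f=g=0$ it forces
   $A(0)=0$. *)
have A0 : A 0 = 0 by have := lA (-1) 0 0; rewrite !scaleN1r oppr0 addr0 addNr.
by have := lA a g 0; rewrite A0 !addr0.
Qed.

Lemma vfieldDr A f g : A (f + g) = A f + A g.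
Proof.
have [lA _] := vfield_derivation A.
by have := lA 1 f g; rewrite !scale1r.
Qed.

Lemma vfield0r A : A 0 = 0.
Proof. by rewrite -(scale0r (0 : Cinf X)) vfieldZr !scale0r. Qed.

Lemma vfieldNr A g : A (- g) = - A g.
Proof. by rewrite -(scaleN1r g) vfieldZr scaleN1r. Qed.

Lemma vfieldMr A f g : A (f * g) = A f * g + f * A g.
Proof. by have [_ ->] := vfield_derivation A. Qed.

Definition vfieldE :=
  (vfield0E, vfieldDE, vfieldNE, vfieldZE, fscaleE, lieE, vfieldDr, vfieldNr, vfield0r,
   vfieldZr, vfieldMr).

Lemma lie_anti A B : lie A B = - lie B A.
Proof. by apply: vfield_ext => g; rewrite !vfieldE opprB. Qed.

Lemma lieDl A B S : lie (A + B) S = lie A S + lie B S.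
Proof. by apply: vfield_ext => g; rewrite !vfieldE; ring. Qed.

Lemma lieZl (a : R) A S : lie (a *: A) S = a *: lie A S.
Proof. by apply: vfield_ext => g; rewrite !vfieldE scalerBr. Qed.

Lemma lieDr S A B : lie S (A + B) = lie S A + lie S B.
Proof. by rewrite lie_anti lieDl opprD -!lie_anti. Qed.

Lemma lieZr (a : R) S A : lie S (a *: A) = a *: lie S A.
Proof. by rewrite lie_anti lieZl -scalerN -lie_anti. Qed.

Lemma lieNl A S : lie (- A) S = - lie A S.
Proof. by rewrite -(scaleN1r A) lieZl scaleN1r. Qed.

Lemma lieNr A S : lie A (- S) = - lie A S.
Proof. by rewrite -(scaleN1r S) lieZr scaleN1r. Qed.

Lemma lie0l S : lie 0 S = 0.
Proof. by rewrite -(scale0r (0 : vfield X)) lieZl !scale0r. Qed.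

Lemma lie0r S : lie S 0 = 0.
Proof. by rewrite lie_anti lie0l oppr0. Qed.

(** Jacobi for brackets taken on the right, the side on which [FN_bracket] puts the symmetry. *)
Lemma lie_jacobi A S T : lie A (lie S T) = lie (lie A S) T - lie (lie A T) S.
Proof. by apply: vfield_ext => g; rewrite !vfieldE; ring. Qed.

Lemma lie_jacobi_l A S T : lie (lie S T) A = lie S (lie T A) - lie T (lie S A).
Proof. by apply: vfield_ext => g; rewrite !vfieldE; ring. Qed.

(** Real scalars act as constant functions, so [vvform1] implies linearity over the reals. *)
Lemma fscale_const (a : R) A : fscale (a *: (1 : Cinf X)) A = a *: A.
Proof. by apply: vfield_ext => g; rewrite !vfieldE -Cinf_scalerAl mul1r. Qed.

Lemma fscaleZl (a : R) f A : fscale (a *: f) A = a *: fscale f A.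
Proof. by apply: vfield_ext => g; rewrite !vfieldE -Cinf_scalerAl. Qed.

Lemma lie_fscale f g A B : lie (fscale f A) (fscale g B) =
  fscale (f * A g) B - fscale (g * B f) A + fscale (f * g) (lie A B).
Proof. by apply: vfield_ext => h; rewrite !vfieldE; ring. Qed.

Lemma vvform1_linear (U : vfield X -> vfield X) (a : R) A B :
  vvform1 U -> U (a *: A + B) = a *: U A + U B.
Proof. by move=> hU; rewrite -!fscale_const hU. Qed.

Lemma FN_bracket_linear (U : vfield X -> vfield X) (a : R) S T A : vvform1 U ->
  FN_bracket U (a *: S + T) A = a *: FN_bracket U S A + FN_bracket U T A.
Proof.
move=> hU; rewrite /FN_bracket !lieDr !lieZr vvform1_linear //.
by rewrite opprD addrACA scalerBr.
Qed.

Lemma FN_bracket_eq (U : vfield X -> vfield X) S T : vvform1 U ->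
  FN_bracket U S = FN_bracket U T <-> forall A, FN_bracket U (S - T) A = 0.
Proof.
move=> hU.
have E A : FN_bracket U (S - T) A = FN_bracket U S A - FN_bracket U T A.
  by rewrite addrC -scaleN1r FN_bracket_linear // scaleN1r addrC.
split=> [eST A|eST]; first by rewrite E eST subrr.
by apply/funext => A; apply/eqP; rewrite -subr_eq0 -E eST.
Qed.

(** Both right brackets commute with $U$ ([eS], [eT]), hence so does their commutator, which is the
    right bracket with $[S,T]$ up to sign. *)
Lemma FN_bracket_lie (U : vfield X -> vfield X) S T : vvform1 U ->
  (forall A, FN_bracket U S A = 0) -> (forall A, FN_bracket U T A = 0) ->
  forall A, FN_bracket U (lie S T) A = 0.
Proof.
move=> hU hS hT A.
have eS B : lie (U B) S = U (lie B S) by apply/eqP; rewrite -subr_eq0; apply/eqP/hS.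
have eT B : lie (U B) T = U (lie B T) by apply/eqP; rewrite -subr_eq0; apply/eqP/hT.
rewrite /FN_bracket !lie_jacobi eS !eT eS.
rewrite [_ - lie (lie A T) S]addrC -[- lie _ _]scaleN1r vvform1_linear //.
by rewrite scaleN1r [- _ + _]addrC subrr.
Qed.

Lemma vertical_linear (Y : fspace R) (h : smap X Y) (a : R) A B :
  vertical h A -> vertical h B -> vertical h (a *: A + B).
Proof. by move=> hA hB f; rewrite !vfieldE hA hB scaler0 addr0. Qed.

Lemma vertical0 (Y : fspace R) (h : smap X Y) : vertical h 0.
Proof. by []. Qed.

Lemma vertical_lie (Y : fspace R) (h : smap X Y) A B :
  vertical h A -> vertical h B -> vertical h (lie A B).
Proof. by move=> hA hB f; rewrite lieE hA hB !vfieldE subrr. Qed.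

End VectorFields.

(** * Cartan distribution, symmetries and the module of vertical Cartan fields *)

Section Symmetries.
Context {R : realType} {E M N : fspace R} (xi : smap E M) (pi : smap M N).
Variable C : vfield M -> vfield E.
Implicit Types (A B S T V W : vfield E).

Lemma cartan_distribution0 : cartan_distribution C 0.
Proof.
have a (i : 'I_0) : Cinf E by case: i.
have Y (i : 'I_0) : vfield M by case: i.
by exists 0%N, a, Y; rewrite big_ord0.
Qed.

Lemma cartan_distribution_fscale (f : Cinf E) (Y : vfield M) :
  cartan_distribution C (fscale f (C Y)).
Proof. by exists 1%N, (fun=> f), (fun=> Y); rewrite big_ord1. Qed.

Lemma cartan_distributionD A B : cartan_distribution C A ->
  cartan_distribution C B -> cartan_distribution C (A + B).
Proof.
move=> [p [a [Y ->]]] [q [b [Z ->]]]; exists (p + q)%N.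
exists (fun i : 'I_(p + q) => match fintype.split i with inl j => a j | inr j => b j end).
exists (fun i : 'I_(p + q) => match fintype.split i with inl j => Y j | inr j => Z j end).
rewrite big_split_ord /=; congr (_ + _); apply: eq_bigr => i _.
  by have /= -> := unsplitK (inl i : 'I_p + 'I_q)%type.
by have /= -> := unsplitK (inr i : 'I_p + 'I_q)%type.
Qed.

(** Additive properties need checking only on the generators $f\,\mathcal{C}Y$. *)
Lemma cartan_distribution_ind (Q : vfield E -> Prop) : Q 0 ->
  (forall A B, Q A -> Q B -> Q (A + B)) ->
  (forall f Y, Q (fscale f (C Y))) -> forall A, cartan_distribution C A -> Q A.
Proof. by move=> Q0 QD QC _ [p [a [Y ->]]]; elim/big_ind: _. Qed.

Lemma cartan_distributionZ (a : R) A :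
  cartan_distribution C A -> cartan_distribution C (a *: A).
Proof.
move: A; apply: cartan_distribution_ind => [|A B hA hB|f Y].
- by rewrite scaler0; exact: cartan_distribution0.
- by rewrite scalerDr; exact: cartan_distributionD.
- by rewrite -fscaleZl; exact: cartan_distribution_fscale.
Qed.

Lemma cartan_distributionN A :
  cartan_distribution C A -> cartan_distribution C (- A).
Proof. by rewrite -scaleN1r; exact: cartan_distributionZ. Qed.

Lemma cartan_distribution_linear (a : R) A B : cartan_distribution C A ->
  cartan_distribution C B -> cartan_distribution C (a *: A + B).
Proof.
by move=> hA hB; apply: cartan_distributionD => //; exact: cartan_distributionZ.
Qed.

(** On generators, the Leibniz rule [lie_fscale] leaves only $[\mathcal{C}Y,\mathcal{C}Z]$ to treat,
    which is $\mathcal{C}[Y,Z]$ by flatness. *)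
Lemma cartan_distribution_lie A B : flat_connection xi C ->
  cartan_distribution C A -> cartan_distribution C B ->
  cartan_distribution C (lie A B).
Proof.
move=> [_ _ flatC] hA; move: B; apply: cartan_distribution_ind.
- by rewrite lie0r; exact: cartan_distribution0.
- by move=> B B'; rewrite lieDr; exact: cartan_distributionD.
move=> g Z; move: A hA; apply: cartan_distribution_ind.
- by rewrite lie0l; exact: cartan_distribution0.
- by move=> A A'; rewrite lieDl; exact: cartan_distributionD.
move=> f Y; rewrite lie_fscale -flatC; apply: cartan_distributionD.
  apply: cartan_distributionD; first exact: cartan_distribution_fscale.
  exact/cartan_distributionN/cartan_distribution_fscale.
exact: cartan_distribution_fscale.
Qed.

Lemma symmetry0 : symmetry xi C 0.
Proof.
split; first exact: vertical0.
by move=> A _; rewrite lie0l; exact: cartan_distribution0.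
Qed.

Lemma symmetry_linear (a : R) S T :
  symmetry xi C S -> symmetry xi C T -> symmetry xi C (a *: S + T).
Proof.
move=> [vS cS] [vT cT]; split; first exact: vertical_linear.
move=> A hA; rewrite lieDl lieZl.
by apply: cartan_distribution_linear; [exact: cS | exact: cT].
Qed.

Lemma symmetry_lie S T :
  symmetry xi C S -> symmetry xi C T -> symmetry xi C (lie S T).
Proof.
move=> [vS cS] [vT cT]; split; first exact: vertical_lie.
move=> A hA; rewrite lie_jacobi_l; apply: cartan_distributionD; first exact/cS/cT.
exact/cartan_distributionN/cT/cS.
Qed.

(** Functions pulled back from $N$ to $\mathcal{E}$ factor through $M$. *)
Lemma vertical_eta S : vertical xi S -> vertical (eta xi pi) S.
Proof.
move=> vS f; rewrite (_ : pull _ f = pull xi (pull pi f)); last by apply: val_inj.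
exact: vS.
Qed.

Lemma vertical_cartan_linear (a : R) V W : vertical_cartan xi pi C V ->
  vertical_cartan xi pi C W -> vertical_cartan xi pi C (a *: V + W).
Proof.
move=> [cV vV] [cW vW]; split; first exact: cartan_distribution_linear.
exact: vertical_linear.
Qed.

Lemma vertical_cartan_lie V W : flat_connection xi C ->
  vertical_cartan xi pi C V -> vertical_cartan xi pi C W ->
  vertical_cartan xi pi C (lie V W).
Proof.
move=> hC [cV vV] [cW vW]; split; first exact: cartan_distribution_lie.
exact: vertical_lie.
Qed.

Lemma symmetry_lie_vertical_cartan S V : symmetry xi C S ->
  vertical_cartan xi pi C V -> vertical_cartan xi pi C (lie S V).
Proof.
move=> [vS cS] [cV vV]; split; first exact: cS.
by apply: vertical_lie => //; exact: vertical_eta.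
Qed.

Lemma exact_symmetry_subalgebra (U : vfield E -> vfield E) :
  flat_connection xi C -> vvform1 U ->
  lie_subalgebra (symmetry xi C) (exact_symmetry xi pi C U).
Proof.
move=> hC hU; split.
- by move=> S [].
- split; first exact: symmetry0.
  by exists 0 => //; split; [exact: cartan_distribution0 | exact: vertical0].
- move=> a S T [sS [V hV eV]] [sT [W hW eW]]; split; first exact: symmetry_linear.
  exists (a *: V + W); first exact: vertical_cartan_linear.
  by apply/funext => A; rewrite !FN_bracket_linear // eV eW.
move=> S T [sS [V hV eV]] [sT [W hW eW]]; split; first exact: symmetry_lie.
(* The potential is $[S,T]-[S-V,T-W]$, expanded; $[V,T]$ appears as $-[T,V]$ so that each mixed
   bracket has its symmetry on the left. *)
exists ((-1) *: lie V W + ((-1) *: lie T V + lie S W)).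
  by do 2?[apply: vertical_cartan_linear];
    [exact: vertical_cartan_lie | exact: symmetry_lie_vertical_cartan ..].
apply/(FN_bracket_eq _ _ _ hU) => A.
move/(FN_bracket_eq _ _ _ hU): eV => eV; move/(FN_bracket_eq _ _ _ hU): eW => eW.
(* Writing $0$ as the bracket of $U$ with $[S-V,T-W]$ reduces the goal to a bilinear identity
   between commutators. *)
rewrite -[RHS](FN_bracket_lie _ _ _ hU eV eW A); congr FN_bracket.
rewrite !scaleN1r lieDl !lieDr !lieNl !lieNr opprK (lie_anti V T).
rewrite !opprD !opprK -!addrA; congr (_ + _).
by rewrite [RHS]addrCA addrC -addrA addrC -addrA.
Qed.

End Symmetries.

Theorem theorem4 (R : realType) (n m d k : nat) (N M P : fspace R)
  (hN : manifold n N) (hM : manifold m M) (hP : manifold d P)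
  (pi : smap M N) (hpi : fiber_bundle pi)
  (rho : smap P M) (hrho : fiber_bundle rho)
  (E0 : set (jetspace rho k)) (hE0 : formally_integrable E0)
  (C : vfield M -> vfield (inf_prolongation E0)) (hC : cartan_connection C)
  (F : vfield N -> vfield (inf_prolongation E0))
  (hF : flat_representation (inf_base E0) pi C F)
  (U : vfield (inf_prolongation E0) -> vfield (inf_prolongation E0))
  (hU : connection_form (inf_base E0) pi F U) :
  lie_subalgebra (symmetry (inf_base E0) C)
    (exact_symmetry (inf_base E0) pi C U).
Proof.
have [hC0 _] := hC; have [hU0 _] := hU.
exact: exact_symmetry_subalgebra.
Qed.
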